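(* Let $s\in(0,1)$, $N>2s$, let $G\subset\mathbb{R}^N$ be an exterior domain with smooth bounded boundary, and let $(u_n)\subset H^s_G$ be a bounded sequence such that, for some $T>0$, $$\lim_{n\to\infty}\ \sup_{y\in\mathbb{R}^N,\ U(y,T)\ne\emptyset}\ \int_{U(y,T)}|u_n|^2dx=0,\qquad U(y,T)=B(y,T)\cap G .$$ Then $$\lim_{n\to\infty}\int_G|u_n|^p\,dx=0\quad\text{for all }p\in(2,2_s^* ).$$
   Context: Here $2_s^*=\frac{2N}{N-2s}$ and $B(y,T)$ is the ball of centre $y$ and radius $T$. An exterior domain is one whose complement $\mathbb{R}^N\setminus G$ is bounded. With $G^c=\mathbb{R}^N\setminus G$, the space $H^s_G$ consists of all measurable $u:\mathbb{R}^N\to\mathbb{R}$ with $$\|u\|_{H^s_G}^2=\frac12\iint_{\mathbb{R}^{2N}\setminus(G^c)^2}\frac{|u(x)-u(y)|^2}{|x-y|^{N+2s}}dy\,dx+\int_G|u|^2dx<\infty ,$$ where $(G^c)^2=G^c\times G^c$; it is normed by $\|\cdot\|_{H^s_G}$. *)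

(* Defs.v *)
From HB Require Import structures.
From mathcomp Require Import all_boot all_order all_algebra.
From mathcomp Require Import all_classical all_reals all_analysis.

Set Implicit Arguments.
Unset Strict Implicit.
Unset Printing Implicit Defensive.
Import Order.TTheory GRing.Theory Num.Theory.
Import numFieldNormedType.Exports.

Local Open Scope classical_set_scope.
Local Open Scope ring_scope.

(* R^n is 'rV[R]_n.  Its base sigma-algebra is generated by the coordinate
   maps (the Borel sets); it is completed further down. *)

Definition measure_rV_display : measure_display.
Proof. exact: default_measure_display. Qed.

Section measurable_rV.
Context {R : realType}.
Variable n : nat.

Let coord (i : 'I_n) (x : 'rV[R]_n) : measurableTypeR R := x ord0 i.

Let rV_set0 : g_sigma_preimage coord set0.
Proof. exact: sigma_algebra0. Qed.

Let rV_setC A : g_sigma_preimage coord A -> g_sigma_preimage coord (~` A).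
Proof. exact: sigma_algebraC. Qed.

Let rV_bigcup (F : (set 'rV[R]_n)^nat) :
  (forall i, g_sigma_preimage coord (F i)) ->
  g_sigma_preimage coord (\bigcup_i (F i)).
Proof. exact: sigma_algebra_bigcup. Qed.

HB.instance Definition _ := @isMeasurable.Build measure_rV_display
  'rV[R]_n (g_sigma_preimage coord) rV_set0 rV_setC rV_bigcup.

End measurable_rV.

Section measurable_rV_theory.
Context {R : realType}.

Lemma measurable_coord n (i : 'I_n) :
  measurable_fun [set: 'rV[R]_n] (fun x => x ord0 i : measurableTypeR R).
Proof.
move=> _ Y mY; rewrite setTI; apply: sub_sigma_algebra => /=.
rewrite -bigcup_seq/=; exists i => /=; first by rewrite mem_index_enum.
by exists Y => //; rewrite setTI.
Qed.

Lemma measurable_fun_coordP d (T : measurableType d) n (f : T -> 'rV[R]_n) :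
  measurable_fun [set: T] f <->
  forall i, measurable_fun [set: T] (fun t => f t ord0 i : measurableTypeR R).
Proof.
split=> [mf i|mf].
  exact: (measurableT_comp (measurable_coord i) mf).
have -> : measurable_fun [set: T] f <->
    preimage_set_system setT f measurable `<=` measurable.
  split=> [h A [/= C mC <-]|h _ A mA]; first exact: h.
  by apply: h; exists A.
rewrite [X in preimage_set_system _ _ X](_ : _ =
  g_sigma_preimage (fun i (x : 'rV[R]_n) => x ord0 i : measurableTypeR R))//.
rewrite -g_sigma_preimage_comp.
apply: smallest_sub; first exact: sigma_algebra_measurable.
rewrite -bigcup_seq => A [i _ [B mB <-]]; exact: mf.
Qed.

Definition cons_rV n (p : measurableTypeR R * 'rV[R]_n) : 'rV[R]_n.+1 :=
  \row_i oapp (p.2 ord0) p.1 (unlift ord0 i).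

Definition uncons_rV n (x : 'rV[R]_n.+1) : measurableTypeR R * 'rV[R]_n :=
  (x ord0 ord0, \row_j x ord0 (lift ord0 j)).

Lemma cons_rVK n : cancel (@cons_rV n) (@uncons_rV n).
Proof.
move=> [a x]; rewrite /uncons_rV !mxE unlift_none/=; congr pair.
by apply/rowP => j; rewrite !mxE liftK.
Qed.

Lemma measurable_cons_rV n : measurable_fun setT (@cons_rV n).
Proof.
apply/measurable_fun_coordP => i.
under eq_fun do rewrite mxE.
case: (unlift ord0 i) => [j|]/=; last exact: measurable_fst.
exact: (measurableT_comp (measurable_coord j) measurable_snd).
Qed.

Lemma measurable_uncons_rV n : measurable_fun setT (@uncons_rV n).
Proof.
apply/measurable_fun_pairP; split => /=; first exact: measurable_coord.
apply/measurable_fun_coordP => i /=.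
rewrite [X in measurable_fun _ X](_ : _ =
  fun x : 'rV[R]_n.+1 => x ord0 (lift ord0 i)); first exact: measurable_coord.
by apply/funext => x /=; rewrite mxE.
Qed.

End measurable_rV_theory.

Section lebesgue_measure_rV.
Context {R : realType}.

Section step.
Variables (n : nat) (m : {sigma_finite_measure set 'rV[R]_n -> \bar R}).

Definition cons_measure : set 'rV[R]_n.+1 -> \bar R :=
  pushforward (@lebesgue_measure R \x m)%E (@cons_rV R n).

Let pushforward_cons : {measure set 'rV[R]_n.+1 -> \bar R} :=
  measure_function_pushforward__canonical__measure_function_Measure
    (@lebesgue_measure R \x m)%E (@measurable_cons_rV R n).

Let cons_measure0 : cons_measure set0 = 0%E.
Proof. by rewrite /cons_measure /pushforward preimage_set0 measure0. Qed.

Let cons_measure_ge0 A : (0 <= cons_measure A)%E.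
Proof. exact: (measure_ge0 pushforward_cons). Qed.

Let cons_measure_sigma_additive : semi_sigma_additive cons_measure.
Proof.
exact: (@measure_semi_sigma_additive _ _ _ pushforward_cons).
Qed.

HB.instance Definition _ := isMeasure.Build _ _ _ cons_measure
  cons_measure0 cons_measure_ge0 cons_measure_sigma_additive.

Let cons_measure_sigma_finite : sigma_finite setT cons_measure.
Proof.
have /sigma_finiteP[F [TF ndF Foo]] := sigma_finiteT (@lebesgue_measure R).
have /sigma_finiteP[G [TG ndG Goo]] := sigma_finiteT m.
exists (fun k => @uncons_rV R n @^-1` (F k `*` G k)).
  apply/esym; rewrite -subTset => x _.
  have : setT (@uncons_rV R n x).1 by [].
  rewrite TF => -[i _ Fi].
  have : setT (@uncons_rV R n x).2 by [].
  rewrite TG => -[j _ Gj].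
  exists (maxn i j) => //; split.
  - by move: Fi; exact/subsetPset/ndF/leq_maxl.
  - by move: Gj; exact/subsetPset/ndG/leq_maxr.
move=> k; have [mF Fk] := Foo k; have [mG Gk] := Goo k; split.
  by rewrite -[X in measurable X]setTI; apply: measurable_uncons_rV => //;
    exact: measurableX.
rewrite /cons_measure /pushforward -comp_preimage.
rewrite (_ : _ \o _ = id) ?preimage_id//; last first.
  by apply/funext => p /=; rewrite cons_rVK.
by rewrite product_measure1E// lte_mul_pinfty// ge0_fin_numE.
Qed.

HB.instance Definition _ := Measure_isSigmaFinite.Build _ _ _ cons_measure
  cons_measure_sigma_finite.

End step.

(* n-fold product of the Lebesgue measure of R, on Borel sets *)
Fixpoint borel_lebesgue_rV n : {sigma_finite_measure set 'rV[R]_n -> \bar R} :=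
  if n is n'.+1 then cons_measure (borel_lebesgue_rV n')
  else @dirac _ 'rV[R]_0 0 R.

End lebesgue_measure_rV.

Section completed_lebesgue.
Context (R : realType) (N : nat).

(* 'rV[R]_N equipped with the sigma-algebra of Lebesgue (Caratheodory)
   measurable sets *)
Definition lebesgue_space :=
  caratheodory_type (@mu_ext _ 'rV[R]_N R (@borel_lebesgue_rV R N)).

HB.instance Definition _ := Measurable.on lebesgue_space.

Definition lebesgue_rV : set lebesgue_space -> \bar R :=
  @completed_measure_extension _ _ R (@borel_lebesgue_rV R N).

HB.instance Definition _ := Measure.on lebesgue_rV.

Let lebesgue_rV_sigma_finite : sigma_finite setT lebesgue_rV.
Proof. exact/completed_measure_extension_sigma_finite/sigma_finiteT. Qed.

HB.instance Definition _ := Measure_isSigmaFinite.Build _ _ _ lebesgue_rV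
  lebesgue_rV_sigma_finite.

End completed_lebesgue.
Arguments lebesgue_rV {R N}.

Section geometry.
Context {R : realType}.

(* The library's norm on 'rV[R]_n is the sup norm; it induces the right
   topology and bounded sets, but |x| below is Euclidean. *)
Definition enorm n (x : 'rV[R]_n) : R := Num.sqrt (\sum_i x ord0 i ^+ 2).

Definition eball n (y : 'rV[R]_n) (r : R) : set 'rV[R]_n :=
  [set x | enorm (x - y) < r].

Fixpoint Ck n (k : nat) (f : 'rV[R]_n -> R) : Prop :=
  if k is k'.+1 then
    (forall x, differentiable f x) /\ (forall v, Ck k' (fun x => 'D_v f x))
  else continuous f.

Definition smooth n (f : 'rV[R]_n -> R) : Prop := forall k, Ck k f.

Definition boundary n (G : set 'rV[R]_n) : set 'rV[R]_n :=
  closure G `\` G°.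

(* Near each boundary point G lies strictly on one side of the graph of a
   smooth function of N - 1 of the coordinates ([col' i x] is x without its
   i-th coordinate), the sign [e] choosing the side. *)
Definition smooth_boundary n (G : set 'rV[R]_n) : Prop :=
  forall x0, boundary G x0 ->
    exists (r : R) (i : 'I_n) (e : bool) (g : 'rV[R]_n.-1 -> R),
      [/\ 0 < r, smooth g &
        forall x, eball x0 r x ->
          (G x <-> g (col' i x) < (-1) ^+ e * x ord0 i)].

Definition domain n (G : set 'rV[R]_n) : Prop :=
  [/\ G !=set0, open G & connected G].

Definition exterior_domain n (G : set 'rV[R]_n) : Prop :=
  domain G /\ bounded_set (~` G).

End geometry.

Section fractional_sobolev.
Context {R : realType} {N : nat}.
Variables (s : R) (G : set 'rV[R]_N).
Implicit Type u : 'rV[R]_N -> R.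

(* The value of the integrand on the (null) diagonal is 0 as 0^-1 = 0. *)
Definition gagliardo u : \bar R :=
  (\int[lebesgue_rV \x lebesgue_rV]_(z in
      ~` ((~` G) `*` (~` G) : set (lebesgue_space R N * lebesgue_space R N)))
    (`|u z.1 - u z.2| ^+ 2
      / enorm ((z.1 : 'rV[R]_N) - (z.2 : 'rV[R]_N)) `^ (N%:R + 2 * s))%:E)%E.

Definition Hs_sqnorm u : \bar R :=
  ((2^-1)%:E * gagliardo u + \int[lebesgue_rV]_(x in G) (`|u x| ^+ 2)%:E)%E.

Definition Hs_space : set ('rV[R]_N -> R) :=
  [set u | measurable_fun [set: lebesgue_space R N] (u : lebesgue_space R N -> R)
           /\ (Hs_sqnorm u < +oo)%E].

Definition Hs_norm u : R := Num.sqrt (fine (Hs_sqnorm u)).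

End fractional_sobolev.

Definition critical_exponent (R : realType) (N : nat) (s : R) : R :=
  2 * N%:R / (N%:R - 2 * s).

(* Main.v *)
Require Import Defs.
From HB Require Import structures.
From mathcomp Require Import all_boot all_order all_algebra.
From mathcomp Require Import all_classical all_reals all_analysis.
From mathcomp Require Import measurable_realfun ring lra.

Set Implicit Arguments.
Unset Strict Implicit.
Unset Printing Implicit Defensive.
Import Order.TTheory GRing.Theory Num.Theory.
Import numFieldNormedType.Exports.

Local Open Scope classical_set_scope.
Local Open Scope ring_scope.

(** The claim is a Lions-type vanishing lemma, and it follows from a pointwise
    estimate that uses no Sobolev embedding.

    Fix a function [u], a point [x] of [G] and set [a = |u x|].  Two facts make
    the Gagliardo energy based at [x], i.e. the integral over [y] in [G] of
    [|u x - u y|^2 / |x - y|^(N + 2s)], large when [a] is large: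
    - [G] is uniformly fat: for all small [rho] the set [G] meets the ball
      [B(x, rho)] in a set of measure at least [(e rho)^N], with [e] independent
      of [x] ([exterior_uniform_cube]);
    - if the integral of [|u|^q] over [B(x, T)] and [G] is small, Chebyshev's
      inequality forbids [|u| > a / 2] on more than half of that set.
    Hence [|u x - u y| >= a / 2] on a set of measure at least [(e rho)^N / 2]
    inside [B(x, rho)], so that the energy at [x] is at least a constant times
    [a^2 rho^(-2s)] ([energy_at_ge]).  Choosing [rho] as the appropriate power
    of [a] turns this into a bound of [a^r] by the energy at [x] plus [a^2],
    with a coefficient that can be made arbitrarily small
    ([powR_le_energy_at]).  It applies as long as [N (r - 2) <= 2 s q].
    Integrating over [x] shows that local vanishing in [L^q] entails global
    vanishing in [L^r] for bounded sequences ([vanishing_step]).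

    Starting from [q = 2] and iterating [q |-> 2 + (2s/N) q], whose fixed point
    is the critical exponent [2N / (N - 2s)], one reaches every subcritical
    exponent in finitely many steps ([vanishing_subcritical]).

    The fatness of [G] is local: at a boundary point [G] lies above the graph of
    a locally Lipschitz function, so that a cube fits above any nearby point of
    [G].  It becomes uniform by compactness, since [G] contains the complement
    of a ball. *)

(** * Euclidean and sup norms, cubes, Lipschitz bounds *)

Section euclid.
Context {R : realType}.

Lemma norm_rV_le n (x : 'rV[R]_n) (c : R) :
  0 <= c -> (forall i, `|x ord0 i| <= c) -> `|x| <= c.
Proof.
move=> c0 h; rewrite /Num.Def.normr/= mx_normrE; apply: bigmax_le => // -[i j] _.
by rewrite (ord1 i).
Qed.

Lemma coord_norm_le n (x : 'rV[R]_n) i : `|x ord0 i| <= `|x|.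
Proof.
rewrite [leRHS]/Num.Def.normr/= mx_normrE.
by apply/bigmax_geP; right; exists (ord0, i).
Qed.

Lemma coord_enorm_le n (x : 'rV[R]_n) i : `|x ord0 i| <= enorm x.
Proof.
rewrite -sqrtr_sqr /enorm ler_wsqrtr// (bigD1 i)//= lerDl.
by apply: sumr_ge0 => j _; exact: sqr_ge0.
Qed.

Lemma enorm_le n (x : 'rV[R]_n) (c : R) :
  0 <= c -> (forall i, `|x ord0 i| <= c) -> enorm x <= n%:R * c.
Proof.
move=> c0 h; have nc0 : 0 <= n%:R * c by rewrite mulr_ge0.
rewrite -[leRHS]ger0_norm// -sqrtr_sqr /enorm ler_wsqrtr//.
apply: (@le_trans _ _ (\sum_(i < n) c ^+ 2)).
  by apply: ler_sum => i _; rewrite -real_normK ?num_real// lerXn2r// nnegrE.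
rewrite sumr_const card_ord exprMn -[leLHS]mulr_natl ler_wpM2r ?sqr_ge0//.
by rewrite expr2 -natrM ler_nat; case: n {x h nc0} => // n; rewrite leq_pmulr.
Qed.

Definition cube n (a : 'rV[R]_n) (h : R) : set 'rV[R]_n :=
  [set x | forall i, a ord0 i <= x ord0 i <= a ord0 i + h].

Lemma subset_cube n (a : 'rV[R]_n) h k : h <= k -> cube a h `<=` cube a k.
Proof. by move=> hk x + i => /(_ i)/andP[-> /le_trans]; apply; rewrite lerD2l. Qed.

(** The factor [n.+1%:R^-1] makes the cube fit into the Euclidean ball, whose
    radius controls the coordinates only up to a factor [n]. *)
Lemma ball_cube n (G : set 'rV[R]_n) (x : 'rV[R]_n) (r : R) :
  ball x r `<=` G -> forall rho, 0 < rho <= r ->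
  exists a, cube a (n.+1%:R^-1 * rho) `<=` G `&` eball x rho.
Proof.
move=> xG rho /andP[rho0 rhor]; exists x => y xy.
have h i : `|(y - x) ord0 i| <= n.+1%:R^-1 * rho.
  have /andP[h1 h2] := xy i.
  by rewrite !mxE ger0_norm ?subr_ge0// lerBlDl.
have k0 : 0 <= n.+1%:R^-1 * rho by rewrite mulr_ge0// ltW.
have kn (m : nat) : (m < n.+1)%N -> m%:R * (n.+1%:R^-1 * rho) < rho.
  by move=> mn; rewrite mulrA gtr_pMl// ltr_pdivrMr// mul1r ltr_nat.
split; last first.
  by rewrite /eball/=; apply: le_lt_trans (enorm_le k0 h) _; exact: kn.
case: n => [|n] in G x xG y xy h k0 kn *.
  apply: xG; rewrite -ball_normE/=.
  apply: le_lt_trans (lt_le_trans rho0 rhor).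
  by apply: norm_rV_le => // -[].
apply: xG; rewrite -ball_normE/= distrC.
apply: le_lt_trans (norm_rV_le k0 h) _.
have := kn 1%N isT; rewrite mul1r => /lt_le_trans; exact.
Qed.

(** Continuity of the partial derivatives bounds them near [w], and the mean
    value theorem along segments turns this into a Lipschitz bound. *)
Lemma smooth_locally_lipschitz n (g : 'rV[R]_n -> R) (w : 'rV[R]_n) :
  Ck 1 g ->
  exists2 L, 0 <= L & exists2 r, 0 < r &
    forall z z', ball w r z -> ball w r z' -> `|g z' - g z| <= L * `|z' - z|.
Proof.
move=> [dg cg].
pose e (j : 'I_n) : 'rV[R]_n := delta_mx ord0 j.
pose B j := `|'D_(e j) g w| + 1.
have B0 j : 0 <= B j by rewrite addr_ge0.
exists (\sum_j B j); first by apply: sumr_ge0 => j _.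
have : \forall z \near w, forall j, `|'D_(e j) g z| <= B j.
  apply: (@filter_forall _ 'I_n (fun j z => `|'D_(e j) g z| <= B j) _ (nbhs_filter w)) => j.
  by apply: cvgr_norm_le (cg (e j) w) _ _; rewrite /B ltrDl.
move=> /nbhs_ballP[r /= r0 hr]; exists r => // z z' wz wz'.
pose v := z' - z; pose h t := g (z + t *: v).
have dh (t : R) : is_derive t 1 h ('D_v g (z + t *: v)).
  have dZ : differentiable (fun t : R => t *: v) t by exact: differentiableZl.
  have dl : differentiable (fun t : R => z + t *: v) t.
    by apply: differentiableD => //; exact: differentiable_cst.
  have dt : differentiable h t by apply: differentiable_comp => //; exact: dg.
  apply: DeriveDef; first exact: diff_derivable.
  rewrite deriveE// /h.
  rewrite (diff_comp dl (dg _)) /= [in RHS]deriveE//.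
  congr ('d g _ _).
  rewrite -deriveE// deriveD; [|exact: derivable_cst|exact: diff_derivable].
  rewrite derive_cst add0r deriveE//.
  have := is_diff_scalel t v; move=> [_ ->].
  by rewrite scale1r.
have ch : {within `[(0:R), 1], continuous h}.
  apply: continuous_subspaceT => t.
  apply: differentiable_continuous.
  by apply/derivable1_diffP; have [] := dh t.
have [c c01] := @MVT R h (fun t => 'D_v g (z + t *: v)) 0 1 ltr01 (fun x _ => dh x) ch.
rewrite /h scale1r scale0r addr0 subr0 mulr1 /v subrKC -/v => ->.
have wzc : ball w r (z + c *: v).
  move: wz wz'; rewrite -!ball_normE/= => wz wz'.
  have -> : w - (z + c *: v) = (1 - c) *: (w - z) + c *: (w - z').
    by rewrite /v !scalerBr !scalerBl !scale1r opprD opprB; apply/rowP => i; rewrite !mxE; lra.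
  apply: le_lt_trans (ler_normD _ _) _; rewrite !normrZ.
  move: c01; rewrite in_itv/= => /andP[c0 c1].
  rewrite !gtr0_norm ?subr_gt0//.
  have -> : r = (1 - c) * r + c * r by lra.
  by apply: ltrD; rewrite ltr_pM2l// subr_gt0.
have -> : 'D_v g (z + c *: v) = \sum_j v ord0 j * 'D_(e j) g (z + c *: v).
  move: (z + c *: v) => y; rewrite (deriveE v (dg y)) [in LHS](row_sum_delta v).
  rewrite linear_sum; apply: eq_bigr => j _.
  by rewrite (deriveE (e j) (dg y)); exact: (linearZZ ('d g y)).
apply: le_trans (ler_norm_sum _ _ _) _; rewrite mulr_suml; apply: ler_sum => j _.
rewrite normrM mulrC ler_pM//; last exact: coord_norm_le.
exact: (hr _ wzc).
Qed.

End euclid.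

(** * Uniform fatness of the exterior domain *)

Section fatness.
Context {R : realType}.

(** Near a boundary point [G] is the region above the graph of a function with
    some Lipschitz constant [L].  From a point [x] of [G], moving upwards by at
    least [L h] while moving by at most [h] in the other coordinates stays above
    the graph.  This leaves room for a cube of side [h], at distance at most
    [(L + 1) h] from [x] in every coordinate. *)
Lemma boundary_cube n (G : set 'rV[R]_n) (x0 : 'rV[R]_n) :
  smooth_boundary G -> boundary G x0 ->
  exists2 k, 0 < k & exists2 r, 0 < r &
    forall x, ball x0 r x -> G x -> forall rho, 0 < rho <= r ->
      exists a, cube a (k * rho) `<=` G `&` eball x rho.
Proof.
move=> sG /sG[r0 [i [e [g [r00 smg gG]]]]].
have [L L0 [r1 r10 Lg]] := smooth_locally_lipschitz (col' i x0) (smg 1%N).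
have n0 : 0 < n.+1%:R :> R by rewrite ltr0n.
pose D : R := n.+1%:R * (L + 1).
have D0 : 0 < D by rewrite mulr_gt0// ltr_pwDr.
pose k := D^-1.
have k0 : 0 < k by rewrite invr_gt0.
have kL : n%:R * ((L + 1) * k) < 1.
  have -> : (L + 1) * k = n.+1%:R^-1.
    by rewrite /k /D invfM mulrCA mulfV ?mulr1// gt_eqF// ltr_pwDr.
  by rewrite ltr_pdivrMr// mul1r ltr_nat.
have kL1 : (L + 1) * k < 1.
  apply: le_lt_trans kL; rewrite ler_peMl ?mulr_ge0 ?addr_ge0 ?(ltW k0)//.
  by rewrite ler1n; apply: leq_ltn_trans (ltn_ord i).
pose r := Num.min (r1 / 4) (r0 / (2 * n.+1%:R)).
have r_gt0 : 0 < r by rewrite lt_min !divr_gt0// mulr_gt0.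
have rr1 : r + r < r1.
  have : r <= r1 / 4 by rewrite ge_min lexx.
  lra.
have rr0 : n.+1%:R * (r + r) <= r0.
  have -> : n.+1%:R * (r + r) = r * (2 * n.+1%:R) by ring.
  by rewrite -ler_pdivlMr ?mulr_gt0// ge_min lexx orbT.
exists k => //; exists r => // x; rewrite -ball_normE/= => x0x Gx rho /andP[rho0 rhor].
pose h := k * rho.
have h0 : 0 < h by rewrite mulr_gt0.
have Lh : L * h + h = (L + 1) * k * rho by rewrite /h; ring.
have Lhr : L * h + h < rho by rewrite Lh gtr_pMl.
have Lh0 : 0 <= L * h by rewrite mulr_ge0// ltW.
(* upwards means in the direction of the [i]-th coordinate, with sign [e] *)
pose a : 'rV[R]_n := \row_j (x ord0 j +
   (if j == i then if e then - (L * h + h) else L * h else 0)).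
exists a => y ay.
have yi : L * h <= (-1) ^+ e * (y ord0 i - x ord0 i).
  have := ay i; rewrite -/h !mxE eqxx; case: (e); rewrite ?expr0 ?expr1; lra.
have yx j : `|(y - x) ord0 j| <= (L + 1) * k * rho.
  have := ay j; rewrite -/h -Lh !mxE; case: ifPn => _; last first.
    by rewrite ler_norml; lra.
  by case: (e) => *; rewrite ler_norml; lra.
have yx' j : j != i -> `|y ord0 j - x ord0 j| <= h.
  move=> ji; have := ay j; rewrite -/h !mxE (negbTE ji) ler_norml; lra.
have Lk0 : 0 <= (L + 1) * k * rho by rewrite -Lh; lra.
have x0y j : `|(y - x0) ord0 j| <= r + r.
  have -> : (y - x0) ord0 j = (y - x) ord0 j - (x0 - x) ord0 j.
    by rewrite !mxE; ring.
  apply: le_trans (ler_normB _ _) _; apply: lerD.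
    by apply: le_trans (yx j) _; rewrite -Lh; lra.
  exact: le_trans (coord_norm_le _ _) (ltW x0x).
have x0x' j : `|(x - x0) ord0 j| <= r + r.
  rewrite (le_trans (coord_norm_le _ _))// distrC.
  by apply: ltW; apply: lt_le_trans x0x _; rewrite lerDl ltW.
have inball z : (forall j, `|(z - x0) ord0 j| <= r + r) -> eball x0 r0 z.
  move=> hz; apply: lt_le_trans rr0; rewrite /eball/=.
  apply: le_lt_trans (enorm_le _ hz) _; first by lra.
  by rewrite ltr_pM2r ?ltr_nat//; lra.
have incol z : (forall j, `|(z - x0) ord0 j| <= r + r) ->
    ball (col' i x0) r1 (col' i z).
  move=> hz; rewrite -ball_normE/= distrC; apply: le_lt_trans rr1.
  apply: norm_rV_le => [|j]; first by rewrite addr_ge0// ltW.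
  by have := hz (lift i j); rewrite !mxE.
split.
  apply/(gG _ (inball _ x0y)).
  have /(gG _ (inball _ x0x')) gx := Gx.
  have gyx := Lg _ _ (incol _ x0x') (incol _ x0y).
  have colyx : `|col' i y - col' i x| <= h.
    apply: norm_rV_le => [|j]; first exact: ltW.
    have := yx' (lift i j); rewrite !mxE; apply.
    by rewrite eq_sym neq_lift.
  have {}gyx : g (col' i y) - g (col' i x) <= L * h.
    apply: le_trans (ler_norm _) _; apply: le_trans gyx _.
    by rewrite ler_wpM2l.
  by move: yi; rewrite mulrBr; lra.
rewrite /eball/=; apply: le_lt_trans (enorm_le Lk0 yx) _.
by rewrite mulrA gtr_pMl.
Qed.

(** A single parameter [e] serves as a bound on the radii and as the ratio of
    the side of the cube to the radius, in the form of a filter statement to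
    which the near-covering characterization of compactness applies. *)
Lemma exterior_local_cube n (G : set 'rV[R]_n) (x0 : 'rV[R]_n) :
  open G -> smooth_boundary G ->
  \forall x \near x0 & e \near 0^'+,
    G x -> forall rho, 0 < rho <= e ->
      exists a, cube a (e * rho) `<=` G `&` eball x rho.
Proof.
move=> oG sG.
suff [k k0 [r r0 kr]] : exists2 k, 0 < k & exists2 r, 0 < r &
    forall x, ball x0 r x -> G x -> forall rho, 0 < rho <= r ->
      exists a, cube a (k * rho) `<=` G `&` eball x rho.
  exists (ball x0 r, [set e | e <= k /\ e <= r]) => /=.
    split; first exact: nbhsx_ballx.
    by near=> e; split; near: e; exact: nbhs_right_le.
  move=> [x e]/= [x0x [ek er]] Gx rho /andP[rho0 rhoe].
  have [|a aG] := kr x x0x Gx rho; first by rewrite rho0 (le_trans rhoe).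
  by exists a; apply: subset_trans aG; apply: subset_cube; rewrite ler_pM2r.
have [/nbhs_ballP[d /= d0 x0G]|nx0] := pselect (nbhs x0 G).
  exists n.+1%:R^-1; first by rewrite invr_gt0.
  exists (d / 2); first by rewrite divr_gt0.
  move=> x x0x _; apply: ball_cube => y xy; apply: x0G.
  by rewrite [d]splitr; exact: ball_triangle x0x xy.
have [x0G|/existsNP[B /not_implyP[x0B GB]]] := pselect (closure G x0).
  exact: boundary_cube.
have /nbhs_ballP[d /= d0 x0d] := x0B.
exists 1 => //; exists d => // x /x0d Bx Gx; exfalso; apply: GB.
by exists x.
Unshelve. all: by end_near. Qed.

(** Inside a large ball the local property is made uniform by compactness;
    outside of it every unit ball is contained in [G]. *)
Lemma exterior_uniform_cube n (G : set 'rV[R]_n) :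
  exterior_domain G -> smooth_boundary G ->
  \forall e \near 0^'+, forall x, G x -> forall rho, 0 < rho <= e ->
      exists a, cube a (e * rho) `<=` G `&` eball x rho.
Proof.
move=> [[_ oG _] [M [_ GM]]] sG.
pose K : set 'rV[R]_n := [set x | `|x| <= M + 2].
have cK : compact K.
  apply: bounded_closed_compact.
    by exists (M + 2); split; [exact: num_real|move=> t tM x /le_trans; apply; exact: ltW].
  have /continuous_closedP cn : continuous (fun x : 'rV[R]_n => `|x|).
    by move=> x; apply: norm_continuous.
  exact: (cn _ (@closed_le R (M + 2))).
pose P (e : R) (x : 'rV[R]_n) := G x -> forall rho, 0 < rho <= e ->
  exists a, cube a (e * rho) `<=` G `&` eball x rho.
have KP : \forall e \near 0^'+, K `<=` P e.
  by apply: (iffLR (compact_near_coveringP K) cK) => x _; exact: exterior_local_cube.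
near=> e => x Gx rho /andP[rho0 rhoe].
have eK : K `<=` P e by near: e.
have [xM|xM] := leP `|x| (M + 2); first by apply: (eK x); rewrite ?rho0.
have [||a aG] := @ball_cube _ _ G x 1 _ rho.
- move=> y; rewrite -ball_normE/= => xy; apply: contrapT => Gy.
  have : `|y| <= M + 1 by apply: GM => //; lra.
  have := ler_distD y x 0; rewrite !subr0; lra.
- rewrite rho0/= (le_trans rhoe)//; near: e; exact: nbhs_right_le.
exists a; apply: subset_trans aG; apply: subset_cube.
by rewrite ler_pM2r//; near: e; exact: nbhs_right_le.
Unshelve. all: by end_near. Qed.

End fatness.

(** * Lebesgue measurability and the measure of cubes *)

Section lebesgue_sets.
Context {R : realType}.

Lemma measurable_lebesgue_space N (A : set 'rV[R]_N) :
  measurable A -> measurable (A : set (lebesgue_space R N)).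
Proof. exact: caratheodory_measurable_mu_ext. Qed.

Lemma lebesgue_rV_borelE N (A : set 'rV[R]_N) :
  measurable A -> lebesgue_rV (A : set (lebesgue_space R N)) = borel_lebesgue_rV N A.
Proof. exact: measurable_mu_extE. Qed.

Lemma measurable_coord_lebesgue N (i : 'I_N) :
  measurable_fun [set: lebesgue_space R N]
    (fun x : lebesgue_space R N => (x : 'rV[R]_N) ord0 i).
Proof.
move=> _ Y mY; apply: measurable_lebesgue_space.
exact: measurable_coord.
Qed.

Lemma measurable_cube N (a : 'rV[R]_N) h : measurable (cube a h).
Proof.
have -> : cube a h = \bigcap_(i in [set: 'I_N])
    ((fun x : 'rV[R]_N => x ord0 i : measurableTypeR R) @^-1`
       `[a ord0 i, a ord0 i + h]%classic).
  by apply/seteqP; split => x /= xa i; have := xa i; rewrite /= in_itv//=; exact.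
apply: fin_bigcap_measurable => // i _; rewrite -[X in measurable X]setTI.
by apply: measurable_coord => //; exact: measurable_itv.
Qed.

Lemma lebesgue_rV_cube N (a : 'rV[R]_N) h : 0 <= h ->
  lebesgue_rV (cube a h : set (lebesgue_space R N)) = (h ^+ N)%:E.
Proof.
move=> h0; rewrite lebesgue_rV_borelE; last exact: measurable_cube.
elim: N a => [|N IH] a /=.
  by rewrite diracE mem_set// => -[].
rewrite /cons_measure /pushforward.
have -> : @cons_rV R N @^-1` cube a h =
    `[a ord0 ord0, a ord0 ord0 + h]%classic `*` cube (\row_j a ord0 (lift ord0 j)) h.
  apply/seteqP; split => -[t x]/=.
    move=> xa; split => [|i].
      by have := xa ord0; rewrite !mxE unlift_none/= in_itv.
    by have := xa (lift ord0 i); rewrite !mxE liftK.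
  move=> [ta xa] i; rewrite !mxE; case: unliftP => [j ->|->]/=.
    by have := xa j; rewrite !mxE.
  by move: ta; rewrite in_itv.
rewrite product_measure1E//; last exact: measurable_cube.
have side (t : R) : lebesgue_measure `[t, t + h]%classic = h%:E.
  rewrite lebesgue_measure_itv/= lte_fin ltrDl.
  case: ltgtP h0 => // [_|<-] _; last by [].
  by rewrite -EFinB addrAC subrr add0r.
by rewrite IH exprS EFinM; congr (_ * _)%E; exact: side.
Qed.

(** The sigma-algebra is generated by the coordinates, so an open set is
    exhibited as the union of the cubes it contains that have a rational corner
    and side [k.+1%:R^-1]. *)
Lemma measurable_open_rV N (G : set 'rV[R]_N) : open G -> measurable G.
Proof.
move=> oG.
pose I := ('rV[rat]_N * nat)%type.
pose Q (q : I) : set 'rV[R]_N :=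
  cube (map_mx ratr q.1) (q.2.+1%:R^-1).
pose F (q : I) : set 'rV[R]_N := if pselect (Q q `<=` G) then Q q else set0.
suff -> : G = \bigcup_q F q.
  apply: countable_bigcupT_measurable; first exact: countableP.
  by move=> q; rewrite /F; case: (pselect (Q q `<=` G)) => [?|?] /=; first exact: measurable_cube.
apply/seteqP; split => x; last by move=> [q _]; rewrite /F; case: (pselect (Q q `<=` G)) => //= h /h.
move=> Gx; have /nbhs_ballP[d /= d0 xG] : nbhs x G by apply: open_nbhs_nbhs.
have [k kd] : exists k : nat, k.+1%:R^-1 < d.
  have [k _ /(_ k (leqnn k)) kd] := near_infty_natSinv_lt (PosNum d0).
  by exists k.
have k0 : (0 : R) < k.+1%:R^-1 by rewrite invr_gt0.
have /choice[c hc] : forall i, exists c : rat, x ord0 i - k.+1%:R^-1 < ratr c < x ord0 i.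
  move=> i; have [|c ] := @rat_in_itvoo R (x ord0 i - k.+1%:R^-1) (x ord0 i).
    by rewrite ltrBlDr ltrDl.
  by rewrite in_itv/= => ?; exists c.
exists (\row_i c i, k) => //; rewrite /F; case: (pselect (Q _ `<=` G)) => /= [QG|].
  by move=> i; rewrite !mxE/=; have /andP[h1 h2] := hc i; rewrite (ltW h2)/= -lerBlDr ltW.
case=> y yQ; apply: xG; rewrite -ball_normE/= distrC; apply: le_lt_trans kd.
apply: norm_rV_le => [|i]; first exact: ltW.
have := yQ i; have := hc i; rewrite !mxE/= ler_norml.
move: (ratr (c i)) (k.+1%:R^-1 : R) => q t /andP[? ?] /andP[? ?]; lra.
Qed.

Lemma measurable_enorm_comp d (T : measurableType d) N (f : T -> 'rV[R]_N) :
  (forall i, measurable_fun setT (fun t => f t ord0 i)) ->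
  measurable_fun setT (fun t => enorm (f t)).
Proof.
move=> mf; rewrite /enorm.
have ms : measurable_fun setT (@Num.sqrt R).
  by apply: continuous_measurable_fun; exact: sqrt_continuous.
apply: (measurableT_comp ms).
by apply: measurable_sum => i; exact: measurable_funX.
Qed.

End lebesgue_sets.

(** * The Gagliardo energy based at a point *)

Section energy.
Context {R : realType} {N : nat}.
Implicit Types (s : R) (G : set 'rV[R]_N) (u : 'rV[R]_N -> R).

Lemma enormN (x : 'rV[R]_N) : enorm (- x) = enorm x.
Proof. by rewrite /enorm; congr Num.sqrt; apply: eq_bigr => i _; rewrite !mxE sqrrN. Qed.

Lemma enorm_gt0 (x : 'rV[R]_N) : x != 0 -> 0 < enorm x.
Proof.
move=> x0; rewrite lt_neqAle sqrtr_ge0 andbT eq_sym.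
apply: contra x0 => /eqP nx0; apply/eqP/rowP => i; rewrite mxE.
by apply/eqP; rewrite -normr_le0 -nx0 coord_enorm_le.
Qed.

Definition gagliardo_density s u (z : 'rV[R]_N * 'rV[R]_N) : R :=
  `|u z.1 - u z.2| ^+ 2 / enorm (z.1 - z.2) `^ (N%:R + 2 * s).

Lemma gagliardo_density_ge0 s u z : 0 <= gagliardo_density s u z.
Proof. by rewrite divr_ge0 ?powR_ge0// sqr_ge0. Qed.

Lemma measurable_gagliardo_density s u :
  measurable_fun [set: lebesgue_space R N] (u : lebesgue_space R N -> R) ->
  measurable_fun [set: lebesgue_space R N * lebesgue_space R N]
    (gagliardo_density s u : lebesgue_space R N * lebesgue_space R N -> R).
Proof.
move=> mu; rewrite /gagliardo_density; under eq_fun do rewrite -powRN.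
apply: measurable_funM.
  apply: measurable_funX; apply: measurableT_comp => //.
  apply: measurable_funB.
    exact: (measurableT_comp mu measurable_fst).
  exact: (measurableT_comp mu measurable_snd).
apply: (measurableT_comp (measurable_powR _)).
apply: measurable_enorm_comp => i.
under eq_fun do rewrite !mxE.
apply: measurable_funB.
  exact: (measurableT_comp (measurable_coord_lebesgue i) measurable_fst).
exact: (measurableT_comp (measurable_coord_lebesgue i) measurable_snd).
Qed.

Definition energy_at s G u (x : 'rV[R]_N) : \bar R :=
  (\int[lebesgue_rV]_(y in (G : set (lebesgue_space R N)))
     (gagliardo_density s u (x, y))%:E)%E.

Lemma energy_at_ge0 s G u x : (0 <= energy_at s G u x)%E.
Proof. by apply: integral_ge0 => y _; rewrite lee_fin gagliardo_density_ge0. Qed.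

Section measurable_data.
Variables (s : R) (G : set 'rV[R]_N) (u : 'rV[R]_N -> R).
Hypothesis mG : measurable (G : set (lebesgue_space R N)).
Hypothesis mu : measurable_fun [set: lebesgue_space R N] (u : lebesgue_space R N -> R).

Lemma measurable_density_at (x : lebesgue_space R N) :
  measurable_fun [set: lebesgue_space R N]
    (fun y : lebesgue_space R N => (gagliardo_density s u (x, y))%:E).
Proof.
apply/measurable_EFinP.
exact: (measurable_fun_pair2 x (measurable_gagliardo_density s mu)).
Qed.

Lemma measurable_norm_powR q :
  measurable_fun [set: lebesgue_space R N]
    (fun y : lebesgue_space R N => (`|u y| `^ q)%:E).
Proof.
apply/measurable_EFinP; apply: (measurableT_comp (measurable_powR q)).
exact: measurableT_comp.
Qed.

(* the density extended by 0 outside of [G `*` G], to which Tonelli applies *)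
Let dGG (z : lebesgue_space R N * lebesgue_space R N) : \bar R :=
  ((fun z => (gagliardo_density s u z)%:E) \_ (G `*` G)) z.

Let dGG_ge0 z : (0 <= dGG z)%E.
Proof. by rewrite /dGG patchE; case: ifP; rewrite ?lee_fin ?gagliardo_density_ge0. Qed.

Let mdGG : measurable_fun setT dGG.
Proof.
apply/(measurable_restrictT _ _).1; first exact: measurableX.
apply: measurable_funTS; apply/measurable_EFinP.
exact: measurable_gagliardo_density.
Qed.

Let energy_at_dGG x : G x -> energy_at s G u x = (\int[lebesgue_rV]_y dGG (x, y))%E.
Proof.
move=> Gx; rewrite /energy_at integral_mkcond; apply: eq_integral => y _.
rewrite /dGG !patchE; congr (if _ then _ else _).
by apply/idP/idP; rewrite !inE/=; [move=> ?; split|move=> -[]].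
Qed.

Lemma measurable_energy_at :
  measurable_fun (G : set (lebesgue_space R N)) (energy_at s G u).
Proof.
apply: (eq_measurable_fun (fun x => \int[lebesgue_rV]_y dGG (x, y))%E).
  by move=> x; rewrite inE => Gx; rewrite energy_at_dGG.
apply: measurable_funTS; exact: measurable_fun_fubini_tonelli_F.
Qed.

(** By Tonelli the left-hand side is the Gagliardo integral restricted to
    [G `*` G], a part of the region that defines [gagliardo]. *)
Lemma integral_energy_le :
  (\int[lebesgue_rV]_(x in (G : set (lebesgue_space R N))) energy_at s G u x
     <= gagliardo s G u)%E.
Proof.
have -> : (\int[lebesgue_rV]_(x in (G : set (lebesgue_space R N))) energy_at s G u x =
    \int[lebesgue_rV]_x \int[lebesgue_rV]_y dGG (x, y))%E.
  rewrite [LHS]integral_mkcond; apply: eq_integral => x _; rewrite patchE.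
  case: ifPn => [|/negP xG]; first by rewrite inE => /energy_at_dGG.
  apply/esym/integral0_eq => y _; rewrite /dGG patchE ifN//.
  by apply/negP; rewrite inE/= => -[Gx _]; apply: xG; rewrite inE.
rewrite -(fubini_tonelli1 dGG)// /dGG -integral_mkcond /gagliardo.
apply: ge0_subset_integral => //.
- exact: measurableX.
- by apply: measurableC; apply: measurableX; apply: measurableC.
- by apply: measurable_funTS; apply/measurable_EFinP; exact: measurable_gagliardo_density.
- by move=> z _; rewrite lee_fin gagliardo_density_ge0.
- by move=> z [Gz _] [].
Qed.

End measurable_data.
End energy.

(** * The pointwise estimate *)

Section pointwise.
Context {R : realType} {N : nat}.
Implicit Types (s : R) (G : set 'rV[R]_N) (u : 'rV[R]_N -> R).

(** By Chebyshev, [|u| > |u x| / 2] on at most half of the cube [cube a h].  On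
    the rest of it, which lies within distance [rho] of [x], the Gagliardo
    density is at least [(|u x| / 2)^2 / rho^(N + 2s)]. *)
Lemma energy_at_ge s G u (x : 'rV[R]_N) (T q d rho h : R) (a : 'rV[R]_N) :
  measurable (G : set (lebesgue_space R N)) ->
  measurable_fun [set: lebesgue_space R N] (u : lebesgue_space R N -> R) ->
  0 < s -> 0 < q -> 0 < rho <= T -> 0 <= h -> u x != 0 ->
  cube a h `<=` G `&` eball x rho ->
  measurable (eball x T `&` G : set (lebesgue_space R N)) ->
  (\int[lebesgue_rV]_(y in (eball x T `&` G : set (lebesgue_space R N)))
     (`|u y| `^ q)%:E <= d%:E)%E ->
  d <= 2^-1 * h ^+ N * (`|u x| / 2) `^ q ->
  ((2^-1 * h ^+ N * (`|u x| ^+ 2 / 4 / rho `^ (N%:R + 2 * s)))%:E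
     <= energy_at s G u x)%E.
Proof.
move=> mG mu s0 q0 /andP[rho0 rhoT] h0 ux0 aG mBG intd dh.
set Q := cube a h in aG.
have mQ : measurable (Q : set (lebesgue_space R N)).
  by apply: measurable_lebesgue_space; exact: measurable_cube.
have ax0 : 0 < `|u x| by rewrite normr_gt0.
pose B : set (lebesgue_space R N) := Q `&` [set y | `|u x| / 2 < `|u y|].
have mB : measurable B.
  apply: measurableI => //.
  have mnu : measurable_fun [set: lebesgue_space R N]
    (fun y : lebesgue_space R N => `|u y|) by exact: measurableT_comp.
  have := mnu measurableT _ (measurable_itv `]`|u x| / 2, +oo[).
  rewrite setTI; congr measurable; apply/seteqP.
  by split => y /=; rewrite in_itv/= andbT.
have cpos : 0 < (`|u x| / 2) `^ q by rewrite powR_gt0// divr_gt0.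
have QBT : B `<=` eball x T `&` G.
  move=> y [/aG[Gy xy] _]; split => //.
  exact: lt_le_trans xy rhoT.
have muB : (lebesgue_rV B <= (2^-1 * h ^+ N)%:E)%E.
  rewrite -(@lee_pmul2l _ ((`|u x| / 2) `^ q)%:E)// ?lte_fin//.
  rewrite -EFinM [X in (_ <= X%:E)%E]mulrC.
  apply: (@le_trans _ _ d%:E); last by rewrite lee_fin.
  apply: le_trans intd.
  rewrite -integral_cst//.
  apply: (@le_trans _ _ (\int[lebesgue_rV]_(y in B) (`|u y| `^ q)%:E)%E).
    apply: ge0_le_integral => //.
    - by move=> y _; rewrite lee_fin ltW.
    - by apply: measurable_funTS; exact: measurable_norm_powR.
    - move=> y [_ /= uy]; rewrite lee_fin.
      have c0 : 0 <= `|u x| / 2 by rewrite divr_ge0.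
      by apply: ge0_ler_powR; rewrite ?nnegrE// ltW.
  apply: ge0_subset_integral => //.
    by apply: measurable_funTS; exact: measurable_norm_powR.
have mQB : measurable (Q `\` B : set (lebesgue_space R N)) by exact: measurableD.
have muQB : ((2^-1 * h ^+ N)%:E <= lebesgue_rV (Q `\` B : set (lebesgue_space R N)))%E.
  have muQ := lebesgue_rV_cube a h0; rewrite -/Q in muQ.
  have BQ : Q `&` B = B by apply/setIidPr => y [].
  have muBfin : lebesgue_rV B \is a fin_num.
    by rewrite ge0_fin_numE//; exact: le_lt_trans muB (ltry _).
  have muQoo : (lebesgue_rV Q < +oo)%E by rewrite muQ ltry.
  have -> : (lebesgue_rV (Q `\` B : set (lebesgue_space R N)) =
      lebesgue_rV Q - lebesgue_rV B)%E.
    by rewrite -[in RHS]BQ; exact: measureD.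
  rewrite muQ leeBrDr// (_ : (h ^+ N)%:E = (2^-1 * h ^+ N)%:E + (2^-1 * h ^+ N)%:E)%E; last first.
    by rewrite -EFinD; congr EFin; lra.
  exact: leeD2l.
apply: (@le_trans _ _ (\int[lebesgue_rV]_(y in (Q `\` B : set (lebesgue_space R N)))
    (`|u x| ^+ 2 / 4 / rho `^ (N%:R + 2 * s))%:E)%E).
  rewrite integral_cst// EFinM muleC lee_wpmul2l// lee_fin.
  by rewrite !divr_ge0 ?sqr_ge0// powR_ge0.
apply: (@le_trans _ _ (\int[lebesgue_rV]_(y in (Q `\` B : set (lebesgue_space R N)))
    (gagliardo_density s u (x, y))%:E)%E); last first.
  apply: ge0_subset_integral => //.
  - by apply: measurable_funTS; exact: measurable_density_at.
  - by move=> y _; rewrite lee_fin gagliardo_density_ge0.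
  - by move=> y [/aG[]].
apply: ge0_le_integral => //.
- by move=> y _; rewrite lee_fin !divr_ge0 ?sqr_ge0// powR_ge0.
- by apply: measurable_funTS; exact: measurable_density_at.
move=> y [Qy nBy]; rewrite lee_fin /gagliardo_density/=.
have uy : `|u y| <= `|u x| / 2 by rewrite leNgt; apply/negP => uy; apply: nBy.
have xy : x != y by apply: contraTneq uy => <-; rewrite -ltNge; lra.
have exy : 0 < enorm (x - y) by rewrite enorm_gt0// subr_eq0.
have Ns : 0 < N%:R + 2 * s by rewrite ltr_wpDl// mulr_gt0.
apply: ler_pM.
- by rewrite divr_ge0// sqr_ge0.
- by rewrite invr_ge0 powR_ge0.
- have : `|u x| / 2 <= `|u x - u y|.
    have := lerB_dist (u x) (u y); lra.
  have -> : `|u x| ^+ 2 / 4 = (`|u x| / 2) ^+ 2 by field.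
  by rewrite ler_sqr ?nnegrE ?divr_ge0.
- rewrite lef_pV2 ?posrE ?powR_gt0// ge0_ler_powR ?nnegrE ?(ltW Ns) ?(ltW exy) ?(ltW rho0)//.
  rewrite -enormN opprB; have [_] := aG _ Qy; exact: ltW.
Qed.

(** The radius [rho] is chosen so that [rho^(-2s) = (a / l)^(r - 2)], where
    [a = |u x|].  If [rho <= e], the lower bound [energy_at_ge] reads
    [a^r <= 8 / e^N * l^(r - 2) * energy_at s G u x]; its smallness condition on
    the local integral holds because [N (r - 2) <= 2 s q] makes
    [(l / a)^q <= rho^N].  If [rho > e], then [a^(r - 2)] is at most
    [l^(r - 2) * e^(-2s)], which is the second term. *)
Lemma powR_le_energy_at s G u (x : 'rV[R]_N) (T q r l e : R) :
  measurable (G : set (lebesgue_space R N)) ->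
  measurable_fun [set: lebesgue_space R N] (u : lebesgue_space R N -> R) ->
  0 < s -> 0 < q -> 2 < r -> N%:R * (r - 2) <= 2 * s * q -> 0 < l ->
  0 < e <= T -> e <= 1 ->
  (forall rho, 0 < rho <= e -> exists a, cube a (e * rho) `<=` G `&` eball x rho) ->
  measurable (eball x T `&` G : set (lebesgue_space R N)) ->
  (\int[lebesgue_rV]_(y in (eball x T `&` G : set (lebesgue_space R N)))
     (`|u y| `^ q)%:E <= (2^-1 * e ^+ N * (l / 2) `^ q)%:E)%E ->
  ((`|u x| `^ r)%:E <= (l `^ (r - 2))%:E *
    ((8 / e ^+ N)%:E * energy_at s G u x + (e `^ (- (2 * s)))%:E * (`|u x| ^+ 2)%:E))%E.
Proof.
move=> mG mu s0 q0 r2 rq l0 /andP[e0 eT] e1 hcube mBG intd.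
have [ux0|ux0] := eqVneq (u x) 0.
  rewrite ux0 normr0 powR0 ?gt_eqF//; last by lra.
  rewrite mule_ge0 ?lee_fin ?powR_ge0// adde_ge0// mule_ge0 ?lee_fin ?powR_ge0 ?energy_at_ge0 ?sqr_ge0//.
  by rewrite divr_ge0// exprn_ge0// ltW.
set a := `|u x|.
have a0 : 0 < a by rewrite normr_gt0.
have t0 : 0 < r - 2 by lra.
have s20 : 0 < 2 * s by lra.
pose rho := (l / a) `^ ((r - 2) / (2 * s)).
have la0 : 0 < l / a by rewrite divr_gt0.
have rho0 : 0 < rho by rewrite powR_gt0.
have rhos : rho `^ (2 * s) = (l / a) `^ (r - 2).
  by rewrite /rho -powRrM divfK// gt_eqF.
have ar : a `^ r = a ^+ 2 * a `^ (r - 2).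
  by rewrite -powR_mulrn ?(ltW a0)// -powRD ?(gt_eqF a0) ?implybT//; congr (_ `^ _); lra.
have arho : a `^ (r - 2) = l `^ (r - 2) * rho `^ (- (2 * s)).
  have -> : l `^ (r - 2) = (l / a) `^ (r - 2) * a `^ (r - 2).
    by rewrite -powRM ?(ltW la0) ?(ltW a0)// divfK// gt_eqF.
  by rewrite powRN rhos mulrAC divff ?mul1r// gt_eqF// powR_gt0.
have [rhoe|erho] := leP rho e.
  have [b bG] := hcube rho (introT andP (conj rho0 rhoe)).
  have er0 : 0 <= e * rho by rewrite mulr_ge0// ltW.
  have la1 : l / a <= 1.
    rewrite leNgt; apply/negP => la1.
    have : 1 < rho.
      have := @gt0_ltr_powR _ _ (divr_gt0 t0 s20) 1 (l / a).
      by rewrite !nnegrE powR1 => /(_ ler01 (ltW la0) la1).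
    by rewrite ltNge (le_trans rhoe).
  have rhoN : (l / a) `^ q <= rho ^+ N.
    rewrite -powR_mulrn ?(ltW rho0)// /rho -powRrM.
    apply: ger_powR; first by rewrite la0.
    rewrite (_ : _ * N%:R = N%:R * (r - 2) / (2 * s)); last by rewrite mulrC mulrA.
    by rewrite ler_pdivrMr// (mulrC q).
  have dle : 2^-1 * e ^+ N * (l / 2) `^ q <= 2^-1 * (e * rho) ^+ N * (a / 2) `^ q.
    have -> : (l / 2) `^ q = (l / a) `^ q * (a / 2) `^ q.
      rewrite -powRM ?(ltW la0) ?divr_ge0 ?(ltW a0)//.
      by rewrite mulrA divfK// gt_eqF.
    have -> : 2^-1 * (e * rho) ^+ N * (a / 2) `^ q =
      2^-1 * e ^+ N * (rho ^+ N * (a / 2) `^ q) by rewrite exprMn; ring.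
    apply: ler_wpM2l; first by rewrite mulr_ge0// exprn_ge0// ltW.
    by apply: ler_wpM2r => //; exact: powR_ge0.
  have rhoNs : rho `^ (N%:R + 2 * s) = rho ^+ N * rho `^ (2 * s).
    by rewrite powRD ?(gt_eqF rho0) ?implybT// powR_mulrn// ltW.
  have h : ((8^-1 * e ^+ N * a ^+ 2 * rho `^ (- (2 * s)))%:E <= energy_at s G u x)%E.
    have := energy_at_ge mG mu s0 q0 (introT andP (conj rho0 (le_trans rhoe eT)))
      er0 ux0 bG mBG intd dle.
    rewrite -/a rhoNs; congr ((_%:E <= _)%E); rewrite exprMn powRN; field.
    by rewrite gt_eqF ?powR_gt0// gt_eqF// exprn_gt0.
  rewrite ar arho.
  apply: (@le_trans _ _ ((l `^ (r - 2))%:E * ((8 / e ^+ N)%:E * energy_at s G u x))%E); last first.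
    rewrite lee_wpmul2l ?lee_fin ?powR_ge0// leeDl// mule_ge0// lee_fin ?powR_ge0// sqr_ge0//.
  have -> : a ^+ 2 * (l `^ (r - 2) * rho `^ (- (2 * s))) =
     l `^ (r - 2) * (8 / e ^+ N * (8^-1 * e ^+ N * a ^+ 2 * rho `^ (- (2 * s)))).
    field. by rewrite gt_eqF// exprn_gt0.
  rewrite EFinM lee_wpmul2l ?lee_fin ?powR_ge0// EFinM lee_wpmul2l// lee_fin.
  by rewrite divr_ge0// exprn_ge0// ltW.
rewrite ar arho.
have re : rho `^ (- (2 * s)) <= e `^ (- (2 * s)).
  rewrite !powRN lef_pV2 ?posrE ?powR_gt0//.
  by rewrite ge0_ler_powR ?nnegrE ?(ltW s20) ?(ltW e0) ?(ltW rho0)// ltW.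
apply: (@le_trans _ _ ((l `^ (r - 2))%:E * ((e `^ (- (2 * s)))%:E * (a ^+ 2)%:E))%E).
  rewrite -!EFinM lee_fin mulrCA ler_wpM2l ?powR_ge0// mulrC ler_wpM2r// sqr_ge0//.
rewrite lee_wpmul2l ?lee_fin ?powR_ge0// leeDr// mule_ge0// ?energy_at_ge0// lee_fin.
by rewrite divr_ge0// exprn_ge0// ltW.
Qed.

End pointwise.

(** * Propagation of vanishing to all subcritical exponents *)

Section vanishing.
Context {R : realType} {N : nat}.
Implicit Types (s : R) (G : set 'rV[R]_N) (u : 'rV[R]_N -> R).

Lemma measurable_eball (y : 'rV[R]_N) T :
  measurable (eball y T : set (lebesgue_space R N)).
Proof.
have me : measurable_fun [set: lebesgue_space R N]
    (fun x : lebesgue_space R N => enorm ((x : 'rV[R]_N) - y)).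
  apply: measurable_enorm_comp => i; under eq_fun do rewrite !mxE.
  by apply: measurable_funB => //; exact: measurable_coord_lebesgue.
have := me measurableT _ (measurable_itv `]-oo, T[).
by rewrite setTI; congr measurable.
Qed.

(** The small coefficient [l^(r - 2)] multiplies quantities that stay bounded
    along the sequence. *)
Lemma integral_powR_le s G u (T q r l e : R) :
  measurable (G : set (lebesgue_space R N)) ->
  measurable_fun [set: lebesgue_space R N] (u : lebesgue_space R N -> R) ->
  0 < s -> 0 < q -> 2 < r -> N%:R * (r - 2) <= 2 * s * q -> 0 < l ->
  0 < e <= T -> e <= 1 ->
  (forall x, G x -> forall rho, 0 < rho <= e ->
     exists a, cube a (e * rho) `<=` G `&` eball x rho) ->
  (forall x, G x ->
    \int[lebesgue_rV]_(y in (eball x T `&` G : set (lebesgue_space R N)))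
     (`|u y| `^ q)%:E <= (2^-1 * e ^+ N * (l / 2) `^ q)%:E)%E ->
  (\int[lebesgue_rV]_(x in (G : set (lebesgue_space R N))) (`|u x| `^ r)%:E <=
   (l `^ (r - 2))%:E * ((8 / e ^+ N)%:E * gagliardo s G u +
     (e `^ (- (2 * s)))%:E *
     \int[lebesgue_rV]_(x in (G : set (lebesgue_space R N))) (`|u x| ^+ 2)%:E))%E.
Proof.
move=> mG mu s0 q0 r2 rq l0 eT e1 hcube intd.
have e0 : 0 < e by case/andP: eT.
have c0 : 0 <= 8 / e ^+ N by rewrite divr_ge0// exprn_ge0// ltW.
have mu2 : measurable_fun (G : set (lebesgue_space R N))
    (fun x : lebesgue_space R N => (`|u x| ^+ 2)%:E).
  apply: measurable_funTS; apply/measurable_EFinP; apply: measurable_funX.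
  exact: measurableT_comp.
have mI := measurable_energy_at s mG mu.
have I0 := fun x (_ : G x) => energy_at_ge0 s G u x.
have u20 : forall x : lebesgue_space R N, G x -> (0 <= (`|u x| ^+ 2)%:E)%E.
  by move=> x _; rewrite lee_fin sqr_ge0.
pose f1 := fun x : lebesgue_space R N => ((8 / e ^+ N)%:E * energy_at s G u x)%E.
pose f2 := fun x : lebesgue_space R N => ((e `^ (- (2 * s)))%:E * (`|u x| ^+ 2)%:E)%E.
have f10 : forall x : lebesgue_space R N, G x -> (0 <= f1 x)%E.
  by move=> x Gx; apply: mule_ge0; rewrite ?lee_fin ?I0.
have f20 : forall x : lebesgue_space R N, G x -> (0 <= f2 x)%E.
  by move=> x Gx; apply: mule_ge0; rewrite ?lee_fin ?powR_ge0// sqr_ge0.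
have mf1 : measurable_fun (G : set (lebesgue_space R N)) f1.
  exact: measurable_funeM.
have mf2 : measurable_fun (G : set (lebesgue_space R N)) f2.
  exact: measurable_funeM.
have le1 : (\int[lebesgue_rV]_(x in (G : set (lebesgue_space R N))) (`|u x| `^ r)%:E <=
   \int[lebesgue_rV]_(x in (G : set (lebesgue_space R N)))
     ((l `^ (r - 2))%:E * (f1 x + f2 x)))%E.
  apply: ge0_le_integral.
  - exact: mG.
  - by move=> x _; rewrite lee_fin powR_ge0.
  - by apply: measurable_funTS; exact: measurable_norm_powR.
  - by apply: measurable_funeM; exact: emeasurable_funD.
  - move=> x Gx; apply: (powR_le_energy_at mG mu s0 q0 r2 rq l0 eT e1 (hcube x Gx) _ (intd x Gx)).
    by apply: measurableI => //; exact: measurable_eball.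
apply: (le_trans le1).
have l0' : (0 <= (l `^ (r - 2))%:E)%E by rewrite lee_fin powR_ge0.
have m12 : measurable_fun (G : set (lebesgue_space R N)) (fun x => f1 x + f2 x)%E.
  exact: emeasurable_funD.
have p12 : forall x : lebesgue_space R N, G x -> (0 <= f1 x + f2 x)%E.
  by move=> x Gx; apply: adde_ge0; [exact: f10|exact: f20].
rewrite (ge0_integralZl lebesgue_rV mG m12 p12 l0').
apply: lee_wpmul2l => //.
rewrite (ge0_integralD lebesgue_rV mG f10 mf1 f20 mf2).
have c0' : (0 <= (8 / e ^+ N)%:E)%E by rewrite lee_fin.
have c1' : (0 <= (e `^ (- (2 * s)))%:E)%E by rewrite lee_fin powR_ge0.
rewrite (ge0_integralZl lebesgue_rV mG mI I0 c0').
rewrite (ge0_integralZl lebesgue_rV mG mu2 u20 c1').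
apply: leeD => //; apply: lee_wpmul2l => //.
exact: integral_energy_le.
Qed.

Section sequence.
Variables (s : R) (G : set 'rV[R]_N) (u : nat -> 'rV[R]_N -> R) (T K : R).
Hypothesis s0 : 0 < s.
Hypothesis T0 : 0 < T.
Hypothesis K0 : 0 <= K.
Hypothesis mG : measurable (G : set (lebesgue_space R N)).
Hypothesis mu : forall n,
  measurable_fun [set: lebesgue_space R N] (u n : lebesgue_space R N -> R).
Hypothesis gK : forall n, (gagliardo s G (u n) <= K%:E)%E.
Hypothesis uK : forall n,
  (\int[lebesgue_rV]_(x in (G : set (lebesgue_space R N))) (`|u n x| ^+ 2)%:E <= K%:E)%E.
Hypothesis Gcube : \forall e \near 0^'+, forall x, G x ->
  forall rho, 0 < rho <= e -> exists a, cube a (e * rho) `<=` G `&` eball x rho.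

Definition locally_vanishing q := forall d, 0 < d -> \forall n \near \oo,
  forall x, G x ->
    (\int[lebesgue_rV]_(y in (eball x T `&` G : set (lebesgue_space R N)))
       (`|u n y| `^ q)%:E <= d%:E)%E.

Definition vanishing r := forall d, 0 < d -> \forall n \near \oo,
  (\int[lebesgue_rV]_(x in (G : set (lebesgue_space R N)))
       (`|u n x| `^ r)%:E <= d%:E)%E.

Lemma vanishing_locally r : vanishing r -> locally_vanishing r.
Proof.
move=> vr d /vr; apply: filterS => n h x Gx; apply: le_trans h.
apply: ge0_subset_integral.
- by apply: measurableI => //; exact: measurable_eball.
- exact: mG.
- by apply: measurable_funTS; exact: measurable_norm_powR.
- by move=> y _; rewrite lee_fin powR_ge0.
- by move=> y [].
Qed.

(** The target [d] and the bound [K] determine [l]; the local integrals fall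
    below the threshold of [integral_powR_le] for that [l] from some index on. *)
Lemma vanishing_step q r : 0 < q -> 2 < r -> N%:R * (r - 2) <= 2 * s * q ->
  locally_vanishing q -> vanishing r.
Proof.
move=> q0 r2 rq vq d d0.
have [e [e0 [eT [e1 hcube]]]] : exists e, 0 < e /\ e <= T /\ e <= 1 /\
    forall x, G x -> forall rho, 0 < rho <= e ->
      exists a, cube a (e * rho) `<=` G `&` eball x rho.
  near (0 : R)^'+ => e; exists e; split => //; split.
    by near: e; exact: nbhs_right_le.
  by split; near: e; [exact: nbhs_right_le|exact: Gcube].
pose C := 8 / e ^+ N * K + e `^ (- (2 * s)) * K.
have r20 : 0 < r - 2 by lra.
have C0 : 0 <= C.
  by rewrite addr_ge0// mulr_ge0 ?powR_ge0// divr_ge0// exprn_ge0// ltW.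
have C10 : 0 < C + 1 by lra.
(* this [l] satisfies [l^(r - 2) * C <= d] *)
pose l := (d / (C + 1)) `^ ((r - 2)^-1).
have l0 : 0 < l by apply: powR_gt0; exact: divr_gt0.
have lC : l `^ (r - 2) * C <= d.
  have -> : l `^ (r - 2) = d / (C + 1).
    by rewrite /l -powRrM mulVf ?gt_eqF// powRr1// divr_ge0// ltW.
  by rewrite mulrAC ler_pdivrMr// ler_pM2l//; lra.
have dl : 0 < 2^-1 * e ^+ N * (l / 2) `^ q.
  by rewrite mulr_gt0 ?powR_gt0 ?divr_gt0// mulr_gt0 ?exprn_gt0.
have := vq _ dl; apply: filterS => n hn.
apply: le_trans (integral_powR_le mG (mu n) s0 q0 r2 rq l0 _ e1 hcube hn) _.
  by rewrite e0.
apply: (@le_trans _ _ ((l `^ (r - 2))%:E * C%:E)%E); last by rewrite -EFinM lee_fin.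
rewrite lee_wpmul2l ?lee_fin ?powR_ge0// /C EFinD !EFinM; apply: leeD.
  by rewrite lee_wpmul2l ?lee_fin// divr_ge0// exprn_ge0// ltW.
by rewrite lee_wpmul2l ?lee_fin ?powR_ge0.
Unshelve. all: by end_near. Qed.

(** With [th = 2s/N] and [c] the critical exponent, the iterates of
    [q |-> 2 + th * q] from [2] are [c * (1 - th^(k + 1))].  They increase to
    [c], since [0 < th < 1]. *)
Lemma vanishing_subcritical p : 2 * s < N%:R -> locally_vanishing 2 ->
  2 < p < critical_exponent N s -> vanishing p.
Proof.
move=> sN v2 /andP[p2 pc].
have N0 : 0 < N%:R :> R by apply: lt_trans sN; rewrite mulr_gt0.
pose th := 2 * s / N%:R.
have th0 : 0 < th by rewrite divr_gt0// mulr_gt0.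
have th1 : th < 1 by rewrite ltr_pdivrMr// mul1r.
have thN : th * N%:R = 2 * s by rewrite divfK// gt_eqF.
pose c := critical_exponent N s.
have cth : c * (1 - th) = 2.
  by rewrite /c /critical_exponent /th; field; rewrite gt_eqF//= gt_eqF// subr_gt0.
have c0 : 0 < c by apply: lt_trans pc; lra.
pose Q k := c * (1 - th ^+ k.+1).
have QS k : Q k.+1 = 2 + th * Q k by rewrite -cth /Q !exprS; ring.
have Q2 k : 2 <= Q k.
  elim: k => [|k IH]; first by rewrite /Q expr1 cth.
  by rewrite QS lerDl mulr_ge0 ?(ltW th0)//; lra.
have vQ k : locally_vanishing (Q k).
  elim: k => [|k IH]; first by rewrite /Q expr1 cth.
  apply: vanishing_locally; apply: vanishing_step IH.
  - by have := Q2 k; lra.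
  - by rewrite QS ltrDl mulr_gt0//; have := Q2 k; lra.
  - by rewrite QS -thN le_eqVlt; apply/orP; left; apply/eqP; ring.
have [k pk] : exists k, p <= Q k.+1.
  have : c * (1 - th ^+ k) @[k --> \oo] --> c * (1 - 0).
    apply: cvgM; first exact: cvg_cst.
    apply: cvgB; first exact: cvg_cst.
    by apply: cvg_expr; rewrite ger0_norm ?(ltW th0).
  rewrite subr0 mulr1 => /cvgr_gt/(_ _ pc)[k _ hk].
  by exists k; apply/ltW/hk => /=; rewrite leqW// leqW.
apply: vanishing_step (vQ k) => //; first by have := Q2 k; lra.
apply: (@le_trans _ _ (N%:R * (Q k.+1 - 2))); first by rewrite ler_pM2l// lerD2r.
by rewrite QS -thN le_eqVlt; apply/orP; left; apply/eqP; ring.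
Qed.

End sequence.
End vanishing.

(** * The theorem *)

Theorem proposition3p1 (R : realType) (N : nat) (s : R)
    (hs : 0 < s < 1) (hN : 2 * s < N%:R)
    (G : set 'rV[R]_N) (hG : exterior_domain G)
    (hdG : smooth_boundary G) (hbG : bounded_set (boundary G))
    (u : nat -> 'rV[R]_N -> R)
    (hu : forall n, Hs_space s G (u n))
    (hub : exists M : R, forall n, Hs_norm s G (u n) <= M)
    (T : R) (hT : 0 < T)
    (hvan : ereal_sup
        [set (\int[lebesgue_rV]_(x in eball y T `&` G) (`|u n x| ^+ 2)%:E)%E
          | y in [set y : 'rV[R]_N | eball y T `&` G !=set0]]
      @[n --> \oo] --> 0%E) :
  forall p : R, 2 < p < critical_exponent N s ->
    (\int[lebesgue_rV]_(x in G) (`|u n x| `^ p)%:E)%E @[n --> \oo] --> 0%E.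
Proof.
move=> p hp; have /andP[s0 _] := hs; have [M hM] := hub.
have mG : measurable (G : set (lebesgue_space R N)).
  by apply: measurable_lebesgue_space; apply: measurable_open_rV; case: hG => -[].
have mu n := (hu n).1.
have gag0 n : (0 <= gagliardo s G (u n))%E.
  by apply: integral_ge0 => z _; rewrite lee_fin gagliardo_density_ge0.
have int0 n : (0 <= \int[lebesgue_rV]_(x in (G : set (lebesgue_space R N))) (`|u n x| ^+ 2)%:E)%E.
  by apply: integral_ge0 => x _; rewrite lee_fin sqr_ge0.
have half_gag0 n : (0 <= (2^-1)%:E * gagliardo s G (u n))%E by rewrite mule_ge0.
have sqnormM n : (Hs_sqnorm s G (u n) <= (M ^+ 2)%:E)%E.
  have [_ foo] := hu n; have sq0 : (0 <= Hs_sqnorm s G (u n))%E by exact: adde_ge0.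
  rewrite -[leLHS]fineK ?ge0_fin_numE// lee_fin.
  rewrite -[leLHS]sqr_sqrtr ?fine_ge0// ler_sqr ?nnegrE ?sqrtr_ge0//.
    exact: hM.
  exact: le_trans (sqrtr_ge0 _) (hM n).
have M0 : 0 <= M ^+ 2 by exact: sqr_ge0.
have gagM n : (gagliardo s G (u n) <= (2 * M ^+ 2)%:E)%E.
  rewrite -(@lee_pmul2l _ (2^-1)%:E)// ?lte_fin//.
  rewrite -EFinM mulKf//; apply: le_trans (sqnormM n).
  exact: leeDl.
have intM n : (\int[lebesgue_rV]_(x in (G : set (lebesgue_space R N)))
    (`|u n x| ^+ 2)%:E <= (2 * M ^+ 2)%:E)%E.
  apply: (@le_trans _ _ (M ^+ 2)%:E); last by rewrite lee_fin; lra.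
  by apply: le_trans (sqnormM n); exact: leeDr.
have v2 : locally_vanishing G u T 2.
  move=> d d0; have /fine_cvgP[fin /cvgr_lt/(_ _ d0)] := hvan.
  apply: filterS2 fin => n fin lt_d x Gx.
  under eq_integral do rewrite powR_mulrn//.
  (* [x] itself is an admissible centre: it belongs to [eball x T `&` G] *)
  apply: (@le_trans _ _ (ereal_sup
        [set (\int[lebesgue_rV]_(x in eball y T `&` G) (`|u n x| ^+ 2)%:E)%E
          | y in [set y : 'rV[R]_N | eball y T `&` G !=set0]])).
    apply: ereal_sup_ubound; exists x => //=; exists x; split => //.
    by rewrite /eball/= subrr /enorm big1 ?sqrtr0// => i _; rewrite mxE expr0n.
  by rewrite -[leLHS]fineK// lee_fin ltW.
have vp := vanishing_subcritical s0 hT (mulr_ge0 (ler0n _ 2) M0) mG mu gagM intM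
  (exterior_uniform_cube hG hdG) hN v2 hp.
have intp0 n : (0 <= \int[lebesgue_rV]_(x in (G : set (lebesgue_space R N))) (`|u n x| `^ p)%:E)%E.
  by apply: integral_ge0 => x _; rewrite lee_fin powR_ge0.
apply/fine_cvgP; split.
  apply: filterS (vp 1 ltr01) => n le1; rewrite ge0_fin_numE//.
  exact: le_lt_trans le1 (ltry _).
apply/cvgrPdist_le => d d0; apply: filterS (vp d d0) => n led /=.
rewrite sub0r normrN ger0_norm ?fine_ge0// -lee_fin fineK//.
by rewrite ge0_fin_numE//; exact: le_lt_trans led (ltry _).
Qed.
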